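(* Let $E=\mathbb{Z}\times\mathbb{Z}_2$ be the square lattice of width $2$. There exists a collective $\mathcal{A}=(A_1,A_2,A_3,A_4,A_5)$ of compassless automata of type $(1,4)$ (one automaton and four pebbles), together with an initial placement of its members on $E$, whose movement on $E$ is directed, i.e. the movement is directed in every implementation of its behaviour $\Pi(\mathcal{A},E)$.
   Context: Environment: $E=\mathbb{Z}\times\mathbb{Z}_2$, where $\mathbb{Z}_2=\{0,1\}$. Two vertices of $E$ are neighbours if they differ by exactly $1$ in exactly one coordinate and agree in the other; the neighbourhood of a vertex is the set of its neighbours (each vertex has exactly three neighbours). A collective $\mathcal{A}=(A_1,\dots,A_{m+1})$ with member set $M$ consists of finite automata moving on the vertices of $E$. Each $A_i=(Q_i,X_i,Y_i,q_i^0,\varphi_i,\psi_i)$ has a finite state set $Q_i$, initial state $q_i^0$, input alphabet $X_i=\{(\alpha,\{\beta,\gamma,\delta\}) : \alpha,\beta,\gamma,\delta\subseteq M\}$ (where $\alpha$ is the set of members at the current vertex and the unordered multiset $\{\beta,\gamma,\delta\}$ lists the sets of members at the three neighbouring vertices), output alphabet $Y_i=\mathcal{P}(M)\cup\{\mathrm{stay}\}$, transition function $\varphi_i:Q_i\times X_i\to Q_i$ and output function $\psi_i:Q_i\times X_i\to Y_i$. Output $\mathrm{stay}$ means stay at the current vertex; output $\varnothing$ means move to some neighbouring vertex containing no members (chosen non-deterministically if there are several); output $y\notin\{\varnothing,\mathrm{stay}\}$ means move to the neighbouring vertex containing exactly the members in $y$. Thus automata are compassless: they distinguish neighbouring vertices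 only by which members occupy them, not by coordinates or direction; members are mutually distinguishable. A collective of type $(1,m)$ consists of one automaton $A_1$ and $m$ pebbles $A_2,\dots,A_{m+1}$, where each pebble $A_j$ has a single state and can move only if $A_1$ is at the same vertex, and then only to the same vertex to which $A_1$ moves (formally: for every input $x$, either $\psi_j(q_j^0,x)=\mathrm{stay}$, or $\psi_j(q_j^0,x)=y\neq\mathrm{stay}$, in which case $A_1\in\alpha$ and $\psi_1(q,x)=y$ for some $q\in Q_1$). The behaviour $\Pi(\mathcal{A},E)$ is the set of all (non-deterministic) runs $(\vec x_t,\vec q_t,\vec y_t)_{t\ge 0}$ obeying $q^j_{t+1}=\varphi_j(q^j_t,x^j_t)$, $y^j_{t+1}=\psi_j(q^j_t,x^j_t)$; each run is an implementation. If $v_i(t)\in E$ is the position of $A_i$ at time $t$, the coordinate of the collective is $v_{\mathcal{A}}(t)=(v_1(t)+\dots+v_{m+1}(t))/(m+1)$, and its diameter is the maximum over all pairs of members and over both coordinates of the absolute difference of their coordinates. The movement of $\mathcal{A}$ in an implementation is directed if there are constants $c_1,c_2\in\mathbb{N}$ such that the diameter is always at most $c_1$ and for every time $t$ there exist natural numbers $t',t''\le c_2$ with $v_{\mathcal{A}}(t+t')-v_{\mathcal{A}}(t)=v_{\mathcal{A}}(t+t'+t'')-v_{\mathcal{A}}(t+t')$. The movement of $\mathcal{A}$ is called directed if it is directed in all implementations of $\Pi(\mathcal{A},E)$. *)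

(* Defs.v *)
From HB Require Import structures.
From mathcomp Require Import all_boot all_order all_algebra zify.
Set Implicit Arguments.
Unset Strict Implicit.
Unset Printing Implicit Defensive.
Import Order.TTheory GRing.Theory Num.Theory.
Local Open Scope ring_scope.

Definition vertex : Type := (int * 'I_2)%type.

Definition adjacent (u v : vertex) : bool :=
  ((`|u.1 - v.1|%N == 1%N) && (u.2 == v.2))
  || ((u.1 == v.1) && (`|(u.2 : nat)%:Z - (v.2 : nat)%:Z|%N == 1%N)).

(* [rev_ord] exchanges the two elements of ['I_2]. *)
Definition neighbours (u : vertex) : 3.-tuple vertex :=
  [tuple (u.1 - 1, u.2); (u.1 + 1, u.2); (u.1, rev_ord u.2)].

Lemma mem_neighbours (u v : vertex) : (v \in neighbours u) = adjacent u v.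
Proof.
case: u v => [x i] [y j].
rewrite /adjacent /neighbours !inE !xpair_eqE /=.
have -> : (j == rev_ord i) = (`|(i : nat)%:Z - (j : nat)%:Z|%N == 1%N).
  by case: i j => [[|[|//]] hi] [[|[|//]] hj].
rewrite (eq_sym j i) (eq_sym y x) orbA -andb_orl.
by congr (_ && _ || _); lia.
Qed.

Lemma uniq_neighbours (u : vertex) : uniq (neighbours u).
Proof.
case: u => x i; rewrite /= !inE !xpair_eqE /= eqxx !andbT.
have -> : (i == rev_ord i) = false by case: i => [[|[|//]] hi].
by rewrite !andbF !orbF andbT; lia.
Qed.

(* The members are indexed by ['I_m.+1]; [ord0] is the automaton and the other
   indices are the pebbles. *)
Definition placement (m : nat) : Type := 'I_m.+1 -> vertex.

Definition members_at (m : nat) (p : placement m) (u : vertex) : {set 'I_m.+1} :=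
  [set i | p i == u].

(* A pair [(alpha, s)]: the members at the current vertex, and those at each of
   the three neighbours. The triple [s] stands for an unordered multiset, see
   [trans_unordered] and [out_unordered]. *)
Definition input (m : nat) : Type :=
  ({set 'I_m.+1} * 3.-tuple {set 'I_m.+1})%type.

(* [None] is "stay". *)
Definition output (m : nat) : Type := option {set 'I_m.+1}.

Record automaton (m : nat) : Type := Automaton {
  state : finType;
  init : state;
  trans : state -> input m -> state;
  out : state -> input m -> output m;
  trans_unordered : forall q alpha (s t : 3.-tuple {set 'I_m.+1}),
    perm_eq s t -> trans q (alpha, s) = trans q (alpha, t);
  out_unordered : forall q alpha (s t : 3.-tuple {set 'I_m.+1}),
    perm_eq s t -> out q (alpha, s) = out q (alpha, t)
}.

Definition collective (m : nat) : Type := 'I_m.+1 -> automaton m.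

Definition of_type_1 (m : nat) (A : collective m) : Prop :=
  forall j : 'I_m.+1, j != ord0 ->
    #|{: state (A j)}| = 1%N /\
    forall x : input m,
      out (init (A j)) x = None \/
      exists y : {set 'I_m.+1},
        [/\ out (init (A j)) x = Some y,
            ord0 \in x.1
          & exists q : state (A ord0), out q x = Some y].

Record config (m : nat) (A : collective m) : Type := Config {
  pos : placement m;
  cur : forall i : 'I_m.+1, state (A i)
}.

Definition observe (m : nat) (p : placement m) (i : 'I_m.+1) : input m :=
  (members_at p (p i), map_tuple (members_at p) (neighbours (p i))).

Definition emitted (m : nat) (A : collective m) (c : config A) (i : 'I_m.+1) :
    output m :=
  out (cur c i) (observe (pos c) i).

(* For [y = Some set0] several [w] may qualify: this is the only source of
   non-determinism. *)
Definition obeys (m : nat) (p : placement m) (u : vertex) (y : output m)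
    (w : vertex) : Prop :=
  if y is Some B then w \in neighbours u /\ members_at p w = B else w = u.

(* One synchronous step of a collective of type (1,m). The last clause says that
   a pebble only moves to the vertex to which the automaton moves; it matters
   when both have output [Some set0] and there are several empty neighbours. *)
Definition step (m : nat) (A : collective m) (c c' : config A) : Prop :=
  [/\ forall i, cur c' i = trans (cur c i) (observe (pos c) i),
      forall i, obeys (pos c) (pos c i) (emitted c i) (pos c' i)
    & forall j, emitted c j <> None -> pos c' j = pos c' ord0].

Definition initial (m : nat) (A : collective m) (p0 : placement m)
    (c : config A) : Prop :=
  forall i, pos c i = p0 i /\ cur c i = init (A i).

Definition implementation (m : nat) (A : collective m) (p0 : placement m)
    (r : nat -> config A) : Prop :=
  initial p0 (r 0%N) /\ forall t, step (r t) (r t.+1).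

(* [obeys] has no solution when an output names a set of members that is not at
   a neighbouring vertex. This says that no such output is ever produced: every
   finite execution can be continued. *)
Definition never_stuck (m : nat) (A : collective m) (p0 : placement m) : Prop :=
  forall (n : nat) (r : nat -> config A),
    initial p0 (r 0%N) ->
    (forall t, (t < n)%N -> step (r t) (r t.+1)) ->
    exists c : config A, step (r n) c.

(* The coordinates 0 and 1 of Z_2 are averaged as numbers. *)
Definition centre (m : nat) (p : placement m) : rat * rat :=
  ((\sum_i (p i).1%:~R) / m.+1%:R, (\sum_i ((p i).2 : nat)%:R) / m.+1%:R).

Definition diameter (m : nat) (p : placement m) : nat :=
  \max_(i < m.+1) \max_(j < m.+1)
    maxn `|(p i).1 - (p j).1|%N
         `|((p i).2 : nat)%:Z - ((p j).2 : nat)%:Z|%N.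

(* With the equation alone a motionless collective would be directed (and
   [t' = t'' = 0] would always do). The repeated displacement is therefore
   required to be a progress along Z, in the same orientation, given by the sign
   of [sigma], at all times. In particular [t'] and [t''] are positive. *)
Definition directed (m : nat) (v : nat -> placement m) : Prop :=
  exists (c1 c2 : nat) (sigma : rat),
    (forall t : nat, (diameter (v t) <= c1)%N) /\
    forall t : nat, exists t' t'' : nat,
      [/\ (t' <= c2)%N, (t'' <= c2)%N,
          centre (v (t + t')%N) - centre (v t)
            = centre (v (t + t' + t'')%N) - centre (v (t + t')%N)
        & 0 < sigma * (centre (v (t + t')%N) - centre (v t)).1].

(* Main.v *)
(** Four pebbles [rear], [middle], [front], [side] form a T: the first three
    are consecutive on one row, [side] is above [middle]. The robot carries
    [rear] onto [middle], then [middle] onto [front]; from there it must carry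
    [front] to one of two indistinguishable empty vertices, ahead of [middle] or
    above it. The neighbourhoods it meets next tell the two cases apart, and in
    both the T is rebuilt one step further along Z. What the robot carries is
    determined by what it sees, so the pebbles need no state.

    The two variants of a cycle pass through different centres, and the
    non-determinism may pick them in any order. An equal repeated displacement
    still exists from every time on, because each variant meets enough residues
    of the centre; for this the robot visits [side] at the end of every cycle,
    which is what its one bit of memory is for. *)

Require Import Defs.
From HB Require Import structures.
From mathcomp Require Import all_boot all_order all_algebra.
From mathcomp Require Import zify.

Section Gait.
Local Open Scope ring_scope.
Import Order.TTheory GRing.Theory Num.Theory.

(** * The table of rules and the collective it defines *)

Definition robot : nat := 0.
Definition rear : nat := 1.
Definition middle : nat := 2.
Definition front : nat := 3.
Definition side : nat := 4.

(** Sets of members become increasing lists of numbers, so that equal sets give equal lists and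
    views can be evaluated. Only the three neighbours are unordered, whence [perm_eq] in
    [matches]. *)
Definition view : Type := (seq nat * seq (seq nat))%type.

Definition matches (v w : view) : bool := (v.1 == w.1) && perm_eq v.2 w.2.

Definition resting : view := ([:: robot; side], [:: [:: middle]; [::]; [::]]).

(* A view, then the pebbles carried and the members at the target. *)
Definition rules : seq (view * (seq nat * seq nat)) := [::
  (resting, ([::], [:: middle]));
  (([:: robot; middle], [:: [:: rear]; [:: front]; [:: side]]),
   ([::], [:: side]));
  (([:: robot; rear], [:: [:: middle]; [::]; [::]]), ([:: rear], [:: middle]));
  (([:: robot; rear; middle], [:: [:: front]; [:: side]; [::]]),
   ([:: middle], [:: front]));
  (([:: robot; middle; front], [:: [:: rear]; [::]; [::]]), ([:: front], [::]));
  (([:: robot; front], [:: [:: middle]; [::]; [::]]), ([::], [:: middle]));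
  (([:: robot; front], [:: [:: middle]; [:: side]; [::]]),
   ([::], [:: middle]));
  (([:: robot; middle], [:: [:: rear]; [:: front]; [::]]), ([::], [:: rear]));
  (([:: robot; rear], [:: [:: middle]; [:: side]; [::]]), ([::], [:: side]));
  (([:: robot; side], [:: [:: rear]; [::]; [::]]), ([:: side], [:: rear]));
  (([:: robot; rear; side], [:: [:: middle]; [::]; [::]]),
   ([:: side], [:: middle]));
  (([:: robot; middle; side], [:: [:: rear]; [:: front]; [::]]),
   ([:: side], [::]));
  (([:: robot; side], [:: [:: rear]; [:: front]; [::]]),
   ([:: side], [:: front]));
  (([:: robot; front; side], [:: [:: middle]; [::]; [::]]),
   ([:: front], [:: middle]));
  (([:: robot; middle; front], [:: [:: rear]; [:: side]; [::]]),
   ([:: front], [::]))].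

Definition lookup (v : view) : option (seq nat * seq nat) :=
  ohead [seq rule.2 | rule <- rules & matches v rule.1].

(* [q] tells that the robot was last seen at [side] in a complete T; it is then
   at [middle], where it now goes to [rear] instead of to [side]. *)
Definition decide (i : nat) (q : bool) (v : view) : option (seq nat) :=
  if lookup v is Some (carried, target) then
    if i == robot then Some (if q then [:: rear] else target)
    else if i \in carried then Some target else None
  else None.

Arguments lookup : simpl never.

Definition labels (B : {set 'I_5}) : seq nat := [seq val i | i <- enum B].

Definition set_of (l : seq nat) : {set 'I_5} := [set i : 'I_5 | val i \in l].

Definition view_of (x : input 4) : view := (labels x.1, map labels x.2).

Lemma matches_perm (a : seq nat) (s t : seq (seq nat)) (w : view) :
  perm_eq s t -> matches (a, s) w = matches (a, t) w.
Proof. by move=> st; rewrite /matches /= (permPl st). Qed.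

Lemma lookup_perm (a : seq nat) (s t : seq (seq nat)) :
  perm_eq s t -> lookup (a, s) = lookup (a, t).
Proof.
move=> st; rewrite /lookup.
by under eq_filter => rule do rewrite (matches_perm a s t rule.1 st).
Qed.

(* Two states for the robot, one for each pebble. *)
Definition member_trans (i : 'I_5) (q : 'I_(i == ord0).+1) (x : input 4) :
    'I_(i == ord0).+1 :=
  inord (matches (view_of x) resting).

Definition member_out (i : 'I_5) (q : 'I_(i == ord0).+1) (x : input 4) :
    output 4 :=
  omap set_of (decide i (q == 1%N :> nat) (view_of x)).

Lemma member_trans_unordered (i : 'I_5) (q : 'I_(i == ord0).+1) alpha
    (s t : 3.-tuple {set 'I_5}) :
  perm_eq s t -> member_trans i q (alpha, s) = member_trans i q (alpha, t).
Proof.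
move=> st; rewrite /member_trans /view_of /=.
by rewrite (matches_perm _ _ (map labels t)) // perm_map.
Qed.

Lemma member_out_unordered (i : 'I_5) (q : 'I_(i == ord0).+1) alpha
    (s t : 3.-tuple {set 'I_5}) :
  perm_eq s t -> member_out i q (alpha, s) = member_out i q (alpha, t).
Proof.
move=> st; rewrite /member_out /view_of /decide /=.
by rewrite (lookup_perm _ _ (map labels t)) // perm_map.
Qed.

Definition walker : collective 4 := fun i =>
  Automaton ord0 (member_trans_unordered i) (member_out_unordered i).

(** A pebble may move only in the presence of the robot; every view in [rules] has the robot at the
    current vertex. *)
Lemma lookup_robot (v : view) : lookup v -> robot \in v.1.
Proof.
rewrite /lookup; set l := [seq _ <- _ | _].
have: forall rule, rule \in l -> (v.1 == rule.1.1) && (robot \in rule.1.1).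
  move=> rule; rewrite mem_filter => /andP[/andP[-> _]] /=.
  by apply/allP: rule; vm_compute.
by case: l => // rule l H _; have /andP[/eqP->] := H rule (mem_head _ _).
Qed.

Lemma mem_labels (i : 'I_5) (B : {set 'I_5}) : (val i \in labels B) = (i \in B).
Proof. by rewrite mem_map ?mem_enum //; apply: val_inj. Qed.

Lemma walker_of_type_1 : of_type_1 walker.
Proof.
move=> j j0; split; first by rewrite /= card_ord (negbTE j0).
move=> x; case E : (out _ x) => [y|]; last by left.
right; exists y; move: E; rewrite /= /member_out /decide.
case L : (lookup _) => [[S y']|] //=.
rewrite (negbTE (j0 : val j != robot)); case: ifP => //= _ [<-].
split=> //; first by rewrite -mem_labels (lookup_robot (view_of x)) ?L.
(* In state 0 the robot outputs the target of the rule, as the pebble does; in state 1 it would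
   output [[:: rear]]. *)
by exists ord0.
Qed.

(** * Placements up to translation along Z, and their successors *)

Definition world : Type := seq vertex.

Definition spot (d : world) (i : nat) : vertex := nth (0, ord0) d i.

Arguments spot : simpl never.

Definition shift (k : int) (v : vertex) : vertex := (k + v.1, v.2).

Definition labels_at (d : world) (v : vertex) : seq nat :=
  [seq i <- iota 0 5 | spot d i == v].

Definition view_at (d : world) (i : nat) : view :=
  (labels_at d (spot d i), map (labels_at d) (neighbours (spot d i))).

Definition placed (d : world) (k : int) (p : placement 4) : Prop :=
  forall i, p i = shift k (spot d (val i)).

Lemma shift_inj (k : int) : injective (shift k).
Proof. by move=> [a i] [b j] [/addrI -> ->]. Qed.

Lemma mem_neighbours_shift (k : int) (u v : vertex) :
  (v \in neighbours (shift k u)) = (v \in [seq shift k w | w <- neighbours u]).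
Proof. by rewrite /= /shift /= !addrA. Qed.

Lemma mem_labels_at (d : world) (v : vertex) (i : 'I_5) :
  (val i \in labels_at d v) = (spot d (val i) == v).
Proof. by rewrite mem_filter mem_iota /= ltn_ord andbT. Qed.

Lemma labels_filter (B : {set 'I_5}) (f : pred nat) :
  (forall i : 'I_5, (i \in B) = f (val i)) ->
  labels B = [seq i <- iota 0 5 | f i].
Proof.
move=> Bf; rewrite /labels -val_enum_ord filter_map enumT.
by congr map; apply: eq_filter.
Qed.

Lemma labels_members_at (d : world) (k : int) (p : placement 4) (v : vertex) :
  placed d k p -> labels (members_at p (shift k v)) = labels_at d v.
Proof.
move=> dp; apply: labels_filter => i.
by rewrite inE dp (inj_eq (@shift_inj k)).
Qed.

(** Members do not perceive translations: what they see is computed from [d] alone, whatever [k]. *)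
Lemma view_of_observe (d : world) (k : int) (p : placement 4) (i : 'I_5) :
  placed d k p -> view_of (observe p i) = view_at d (val i).
Proof.
move=> dp; have := labels_members_at _ _ _ _ dp => lab.
rewrite /view_of /view_at /observe /= !dp lab; congr pair.
by rewrite /map_tuple /= -!lab /shift /= !addrA.
Qed.

(** This makes the condition in [obeys] decidable by computation; filtering [iota 0 5] puts [l] in
    increasing order. *)
Lemma members_at_set_of (d : world) (k : int) (p : placement 4) (v : vertex)
    (l : seq nat) :
  placed d k p ->
  members_at p (shift k v) = set_of l <->
  labels_at d v = [seq i <- iota 0 5 | i \in l].
Proof.
move=> dp; split=> [eq_l | lab].
  rewrite -(labels_members_at _ _ _ _ dp) eq_l.
  by apply: labels_filter => i; rewrite inE.
apply/setP=> i; rewrite !inE dp (inj_eq (@shift_inj k)) -mem_labels_at lab.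
by rewrite mem_filter mem_iota /= ltn_ord andbT.
Qed.

Lemma spot_map_iota (f : nat -> vertex) (i : 'I_5) :
  spot [seq f j | j <- iota 0 5] (val i) = f (val i).
Proof.
by rewrite /spot (nth_map 0%N) ?size_iota ?ltn_ord // nth_iota ?ltn_ord.
Qed.

Definition shifted (k : int) (d : world) : world :=
  [seq shift k (spot d i) | i <- iota 0 5].

Definition targets (q : bool) (d : world) : seq vertex :=
  if decide robot q (view_at d robot) is Some y then
    [seq v <- neighbours (spot d robot)
        | labels_at d v == [seq i <- iota 0 5 | i \in y]]
  else [::].

Definition moved (q : bool) (d : world) (v : vertex) : world :=
  [seq if decide i q (view_at d i) then v else spot d i | i <- iota 0 5].

(** [targets] consults the robot only; a step to [v] exists if the outputs of the carried pebbles
    can be obeyed there too. *)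
Definition legal (q : bool) (d : world) (v : vertex) : bool :=
  all (fun i =>
    if decide i q (view_at d i) is Some y then
      (v \in neighbours (spot d i)) &&
      (labels_at d v == [seq j <- iota 0 5 | j \in y])
    else true) (iota 0 5).

Definition bit (c : config walker) : bool := (cur c ord0 : 'I_2) == 1%N :> nat.

Lemma emitted_decide (d : world) (k : int) (c : config walker) (i : 'I_5) :
  placed d k (pos c) ->
  emitted c i = omap set_of (decide (val i) (bit c) (view_at d (val i))).
Proof.
move=> dc; rewrite /emitted /= /member_out (view_of_observe _ _ _ _ dc).
have [i0|i0] := boolP (val i == robot); last by rewrite /decide (negbTE i0).
by have -> : i = ord0 by apply/val_inj/eqP.
Qed.

Lemma moved_at (q : bool) (d : world) (v : vertex) (i : 'I_5) :
  spot (moved q d v) (val i) =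
    if decide (val i) q (view_at d (val i)) then v else spot d (val i).
Proof. exact: spot_map_iota. Qed.

(** The only choice is the destination of the robot: moving pebbles must follow it, and all other
    members stay. *)
Lemma step_targets (d : world) (k : int) (c c' : config walker) :
  placed d k (pos c) -> isSome (decide robot (bit c) (view_at d robot)) ->
  step c c' ->
  bit c' = matches (view_at d robot) resting /\
  exists2 v, v \in targets (bit c) d
           & placed (moved (bit c) d v) k (pos c').
Proof.
move=> dc act [cur' obey follow]; split.
  rewrite /bit cur' /= /member_trans (view_of_observe _ _ _ _ dc) inordK.
    by case: matches.
  by case: matches.
case D: (decide robot _ _) act => [y|//] _.
have := obey ord0; rewrite (emitted_decide _ _ _ _ dc) D /=.
rewrite dc mem_neighbours_shift => -[/mapP[v v_nb pos0]].
rewrite pos0 => /(members_at_set_of _ _ _ _ _ dc) lab.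
exists v; first by rewrite /targets D mem_filter lab eqxx.
move=> i; rewrite moved_at.
have := obey i; have := follow i; rewrite (emitted_decide _ _ _ _ dc).
by case: decide => [z|] /=; [move=> -> // _ | move=> _ ->].
Qed.

Lemma targets_step (d : world) (k : int) (c : config walker) (v : vertex) :
  placed d k (pos c) -> legal (bit c) d v ->
  isSome (decide robot (bit c) (view_at d robot)) ->
  exists c', step c c'.
Proof.
move=> dc /allP leg act.
exists (Config (A := walker)
  (fun i => shift k (spot (moved (bit c) d v) (val i)))
  (fun i => trans (cur c i) (observe (pos c) i))).
split=> [//|i|j] /=; rewrite (emitted_decide _ _ _ _ dc) ?moved_at.
  have := leg (val i); rewrite mem_iota /= ltn_ord => /(_ isT).
  case: decide => [y|] /= => [/andP[v_nb /eqP lab]|_]; last by rewrite dc.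
  split; last exact/(members_at_set_of _ _ _ _ _ dc).
  by rewrite dc mem_neighbours_shift map_f.
have /= := moved_at (bit c) d v ord0; rewrite act => ->.
by case: decide.
Qed.

(** * The finite graph of phases *)

(* Phases 0 to 10 form the cycle in which [front] goes ahead; if it goes above
   [middle], phase 4 is followed by the phases 11 to 18 instead. *)
Definition phases : seq (bool * world) :=
  let up := ord_max : 'I_2 in
  let bot := ord0 : 'I_2 in
  let w (a r m f s : vertex) := [:: a; r; m; f; s] in
  [:: (false, w (1, up) (0, bot) (1, bot) (2, bot) (1, up));
      (true, w (1, bot) (0, bot) (1, bot) (2, bot) (1, up));
      (false, w (0, bot) (0, bot) (1, bot) (2, bot) (1, up));
      (false, w (1, bot) (1, bot) (1, bot) (2, bot) (1, up));
      (false, w (2, bot) (1, bot) (2, bot) (2, bot) (1, up));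
      (false, w (3, bot) (1, bot) (2, bot) (3, bot) (1, up));
      (false, w (2, bot) (1, bot) (2, bot) (3, bot) (1, up));
      (false, w (1, bot) (1, bot) (2, bot) (3, bot) (1, up));
      (false, w (1, up) (1, bot) (2, bot) (3, bot) (1, up));
      (false, w (1, bot) (1, bot) (2, bot) (3, bot) (1, bot));
      (false, w (2, bot) (1, bot) (2, bot) (3, bot) (2, bot));
      (false, w (2, up) (1, bot) (2, bot) (2, up) (1, up));
      (false, w (2, bot) (1, bot) (2, bot) (2, up) (1, up));
      (false, w (1, bot) (1, bot) (2, bot) (2, up) (1, up));
      (false, w (1, up) (1, bot) (2, bot) (2, up) (1, up));
      (false, w (2, up) (1, bot) (2, bot) (2, up) (2, up));
      (false, w (2, bot) (1, bot) (2, bot) (2, bot) (2, up));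
      (false, w (3, bot) (1, bot) (2, bot) (3, bot) (2, up));
      (false, w (2, bot) (1, bot) (2, bot) (3, bot) (2, up))].

Definition phase (n : nat) : bool * world := nth (false, [::]) phases n.

(* The integer is the translation of the frame in which [phases] is given. *)
Definition next (n : nat) : seq (nat * int) :=
  if n == 4%N then [:: (5%N, 0); (11%N, 0)]
  else if (n == 10%N) || (n == 18%N) then [:: (0%N, 1)]
  else [:: (n.+1, 0)].

(** The second conjunct serves to continue executions, the third to show that no choice leaves the
    graph. *)
Definition phase_ok (n : nat) : bool :=
  let: (q, d) := phase n in
  [&& isSome (decide robot q (view_at d robot)),
      has (legal q d) (targets q d)
    & all (fun v => has (fun s =>
        let: (q', d') := phase s.1 in
        [&& (s.1 < 19)%N, matches (view_at d robot) resting == q'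
          & moved q d v == shifted s.2 d'])
        (next n)) (targets q d)].

Lemma phase_okP (n : nat) : (n < 19)%N -> phase_ok n.
Proof.
move=> n19; have: all phase_ok (iota 0 19) by vm_compute.
by move/allP; apply; rewrite mem_iota.
Qed.

(* The coordinates of the centre multiplied by 5. *)
Definition tally (x : nat * int) : int * nat :=
  let d := (phase x.1).2 in
  ((spot d 0).1 + ((spot d 1).1 +
     ((spot d 2).1 + ((spot d 3).1 + (spot d 4).1))) + 5 * x.2,
   ((spot d 0).2 + ((spot d 1).2 +
     ((spot d 2).2 + ((spot d 3).2 + (spot d 4).2))))%N).

Fixpoint futures (L n : nat) : seq (seq (nat * int)) :=
  if L is L'.+1 then
    [seq (n, 0) :: [seq (x.1, s.2 + x.2) | x <- f]
        | s <- next n, f <- futures L' s.1]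
  else [:: [:: (n, 0)]].

Lemma size_futures (L n : nat) (f : seq (nat * int)) :
  f \in futures L n -> size f = L.+1.
Proof.
elim: L n f => [|L IH] n f /=; first by rewrite inE => /eqP->.
by case/allpairsPdep=> s [g] [_ /IH size_g ->]; rewrite /= size_map size_g.
Qed.

(** The equation of [directed] is written with sums because second coordinates are natural numbers.
    The range of [t''] keeps [t' + t''] within a list of size [L.+1], away from the default of
    [nth]. *)
Definition balanced (L : nat) (c : seq (int * nat)) : bool :=
  let c_ := nth (0, 0%N) c in
  has (fun t' => ((c_ 0%N).1 < (c_ t').1) &&
    has (fun t'' => let c2 := c_ (t' + t'')%N in
      ((c_ t').1 + (c_ t').1 == (c_ 0%N).1 + c2.1) &&
      ((c_ t').2 + (c_ t').2 == (c_ 0%N).2 + c2.2)%N) (iota 0 (L - t').+1))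
    (iota 0 L.+1).

(** * Runs as walks in the graph of phases *)

Definition in_phase (x : nat * int) (c : config walker) : Prop :=
  [/\ (x.1 < 19)%N, bit c = (phase x.1).1 & placed (phase x.1).2 x.2 (pos c)].

Lemma in_phase_step (n : nat) (k : int) (c c' : config walker) :
  in_phase (n, k) c -> step c c' ->
  exists2 s, s \in next n & in_phase (s.1, k + s.2) c'.
Proof.
case=> /= n19 qc dc; have := phase_okP n n19.
rewrite /phase_ok; case: (phase n) qc dc => q d /= qc dc /and3P[act _ ok] st.
rewrite -qc in act ok.
have [bit' [v v_tg dc']] := step_targets _ _ _ _ dc act st.
have /hasP[s s_next] := allP ok v v_tg.
rewrite -bit'; case E : (phase s.1) => [q' d'].
case/and3P=> s19 /eqP q'E /eqP mv.
exists s => //; split; rewrite //= E //= => i; rewrite dc' mv.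
by rewrite spot_map_iota /shift /= addrA.
Qed.

Lemma in_phase_progress (n : nat) (k : int) (c : config walker) :
  in_phase (n, k) c -> exists c', step c c'.
Proof.
case=> /= n19 qc dc; have := phase_okP n n19.
rewrite /phase_ok; case: (phase n) qc dc => q d /= <- dc /and3P[act leg _].
by have /hasP[v _ v_leg] := leg; apply: targets_step dc v_leg act.
Qed.

Definition start : placement 4 := fun i => spot (phase 0).2 (val i).

Lemma initial_in_phase (c : config walker) :
  initial start c -> in_phase (0%N, 0) c.
Proof.
move=> ini; split=> // [|i].
  by rewrite /bit (ini ord0).2.
by rewrite (ini i).1 /start /shift add0r -surjective_pairing.
Qed.

(** Finite executions are what [never_stuck] quantifies over; an infinite run is handled through its
    prefixes. *)
Lemma run_in_phase (N : nat) (r : nat -> config walker) :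
  initial start (r 0%N) -> (forall t, (t < N)%N -> step (r t) (r t.+1)) ->
  forall t, (t <= N)%N -> exists x, in_phase x (r t).
Proof.
move=> ini st; elim=> [_|t IH tN].
  by exists (0%N, 0); apply: initial_in_phase.
have [[n k] ph] := IH (ltnW tN).
by have [s _ ph'] := in_phase_step _ _ _ _ ph (st _ tN); exists (s.1, k + s.2).
Qed.

Lemma walker_never_stuck : never_stuck walker start.
Proof.
move=> N r ini st; have [[n k]] := run_in_phase _ _ ini st _ (leqnn N).
exact: in_phase_progress.
Qed.

(** Any window of a run is one of finitely many walks, up to the translation [k], so properties of
    windows reduce to a finite check. *)
Lemma futuresP (r : nat -> config walker) :
  (forall t, step (r t) (r t.+1)) ->
  forall (L t n : nat) (k : int), in_phase (n, k) (r t) ->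
  exists2 f, f \in futures L n
    & forall j, (j <= L)%N ->
        in_phase ((nth (0%N, 0) f j).1, k + (nth (0%N, 0) f j).2) (r (t + j)%N).
Proof.
move=> st; elim=> [|L IH] t n k ph.
  by exists [:: (n, 0)]; rewrite ?inE // => -[|//] _; rewrite /= addr0 addn0.
have [s s_next ph'] := in_phase_step _ _ _ _ ph (st t).
have [f f_fut fP] := IH _ _ _ ph'.
exists ((n, 0) :: [seq (x.1, s.2 + x.2) | x <- f]).
  by apply/allpairsPdep; exists s, f.
case=> [|j] jL; first by rewrite /= addr0 addn0.
rewrite addnS -addSn /=; have := fP j jL.
by rewrite (nth_map (0%N, 0)) ?(size_futures _ _ _ f_fut) //= addrA.
Qed.

(** * Centre, diameter and directedness *)

Lemma centre_placed (x : nat * int) (c : config walker) :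
  in_phase x c ->
  centre (pos c) = ((tally x).1%:~R / 5%:R, (tally x).2%:R / 5%:R).
Proof.
case=> _ _ dc; rewrite /centre; congr (_ / _, _ / _).
  rewrite -rmorph_sum /=; congr (_%:~R).
  by rewrite !big_ord_recl big_ord0 !dc /= /bump !add1n; lia.
by rewrite !big_ord_recl big_ord0 !dc /= /bump !add1n addr0 -!natrD.
Qed.

Lemma diameter_placed (x : nat * int) (c : config walker) :
  in_phase x c -> (diameter (pos c) <= 3)%N.
Proof.
case=> n19 _ dc; apply/bigmax_leqP => i _; apply/bigmax_leqP => j _.
(* The common translation cancels, which leaves a check on each phase. *)
rewrite !dc /= opprD addrACA subrr add0r.
have: all (fun n => all (fun u : vertex => all (fun v : vertex =>
    (maxn `|u.1 - v.1| `|(u.2 : nat)%:Z - (v.2 : nat)%:Z| <= 3)%N)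
  [seq spot (phase n).2 i | i <- iota 0 5])
  [seq spot (phase n).2 i | i <- iota 0 5]) (iota 0 19) by vm_compute.
move/allP/(_ x.1); rewrite mem_iota => /(_ n19) /allP H.
have mem_at (l : 'I_5) : spot (phase x.1).2 (val l)
    \in [seq spot (phase x.1).2 i | i <- iota 0 5].
  by apply: map_f; rewrite mem_iota /= ltn_ord.
exact: (allP (H _ (mem_at i)) _ (mem_at j)).
Qed.

(* 26 is twice the length of the longer cycle. *)
Lemma balanced_futures (n : nat) (f : seq (nat * int)) :
  (n < 19)%N -> f \in futures 26 n -> balanced 26 (map tally f).
Proof.
move=> n19.
have: all (fun n => all (fun f => balanced 26 (map tally f)) (futures 26 n))
  (iota 0 19) by vm_compute.
by move/allP => /(_ n); rewrite mem_iota => /(_ n19) /allP; apply.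
Qed.

Lemma walker_directed (r : nat -> config walker) :
  implementation start r -> directed (fun t => pos (r t)).
Proof.
(* The diameter bound, the length of the windows, and the orientation towards increasing first
   coordinates. *)
case=> ini st; exists 3%N, 26%N, 1.
have ph t : exists x, in_phase x (r t).
  exact: run_in_phase ini (fun u _ => st u) t (leqnn t).
split=> t; first by have [x /diameter_placed] := ph t.
have [[n k] phx] := ph t.
have [f f_fut fP] := futuresP r st 26 t n k phx.
have n19 : (n < 19)%N by case: phx.
have size_f := size_futures _ _ _ f_fut.
have := balanced_futures _ _ n19 f_fut.
set c := map tally f.
(* [tally] sums over five members, so a translation by [k] adds [5 * k]; this term cancels in every
   difference below. *)
have centreP j : (j <= 26)%N -> centre (pos (r (t + j)%N)) =
    (((nth (0, 0%N) c j).1 + 5 * k)%:~R / 5%:R,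
     (nth (0, 0%N) c j).2%:R / 5%:R).
  move=> j26; rewrite (centre_placed _ _ (fP j j26)).
  by rewrite (nth_map (0%N, 0)) ?size_f // /tally /= mulrDr addrA addrAC.
have c0 := centreP 0%N isT; rewrite addn0 in c0.
case/hasP=> t'; rewrite mem_iota add0n ltnS => /andP[_ t'26] /andP[x01].
case/hasP=> t''; rewrite mem_iota add0n ltnS => /andP[_ t''26].
case/andP=> /eqP x12 /eqP y12.
have c1 := centreP t' t'26.
have t26 : (t' + t'' <= 26)%N by rewrite -leq_subRL.
have c2 := centreP _ t26; exists t', t''.
rewrite -addnA c0 c1 c2 /= {c0 c1 c2 centreP}.
move: (nth _ c 0) (nth _ c t') (nth _ c (t' + t'')) x01 x12 y12.
move=> [x0 y0] [x1 y1] [x2 y2] /= x01 x12 y12.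
split=> //; first by lia.
  congr pair; rewrite /= -!mulrBl; congr (_ / _).
    by rewrite -!rmorphB; congr (_%:~R); lia.
  (* Moving the negative terms across returns to the sums of naturals in [balanced]. *)
  apply/eqP; rewrite subr_eq addrAC eq_sym subr_eq -!natrD eqr_nat.
  by rewrite y12 addnC.
by rewrite mul1r -mulrBl -rmorphB divr_gt0 // ltr0z; lia.
Qed.

End Gait.

Theorem theorem2 :
  exists (A : collective 4) (p0 : placement 4),
    [/\ of_type_1 A,
        never_stuck A p0
      & forall r : nat -> config A,
          implementation p0 r -> directed (fun t => pos (r t))].
Proof.
exists walker, start; split.
- exact: walker_of_type_1.
- exact: walker_never_stuck.
- exact: walker_directed.
Qed.
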